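(* Let $G=(V,E)$ be a uniformly transient graph with bounded degrees. Then $$\liminf_{n\to\infty}\ \inf_{o\in V}\ \frac{H_o(R_n)}{\langle R_n\rangle_o}>0 .$$
   Context: $G=(V,E)$ is a graph with vertex set $V$ and edges given by unordered pairs of vertices; $x\sim y$ means $\{x,y\}\in E$, and $\deg(x)$ is the number of neighbors of $x$, always assumed finite, and at least $1$ so that the walk below is defined. $G$ has bounded degrees if $\sup_{x\in V}\deg(x)<\infty$. $G$ is not assumed to be connected. For $o\in V$, $P_o$ (with expectation $E_o$) is the law of the simple random walk $(X_n)_{n\ge 0}$ on $G$ started at $X_0=o$, i.e. the Markov chain with transition probabilities $p(x,y)=1/\deg(x)$ if $x\sim y$ and $0$ otherwise. The range is $R_n=\{X_0,X_1,\dots,X_n\}$ (a random finite set of vertices), its expected size is $\langle R_n\rangle_o=E_o[|R_n|]$, and its entropy is $H_o(R_n)=\sum_{A}P_o[R_n=A]\log\big(1/P_o[R_n=A]\big)$, the sum being over all finite connected sets $A\subseteq V$ containing $o$, with $0\log(1/0)=0$. $G$ is uniformly transient if $\inf_{o\in V}P_o[o\notin\{X_1,X_2,\dots\}]>0$. *)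

(* Defs.v *)
From HB Require Import structures.
From mathcomp Require Import all_boot all_order all_algebra finmap.
From mathcomp Require Import all_classical all_reals all_analysis.
Set Implicit Arguments.
Unset Strict Implicit.
Unset Printing Implicit Defensive.
Import Order.TTheory GRing.Theory Num.Theory.
Local Open Scope classical_set_scope.
Local Open Scope fset_scope.
Local Open Scope ring_scope.

Record simple_graph (V : choiceType) := SimpleGraph {
  adj : rel V;
  adj_sym : symmetric adj;
  adj_irr : irreflexive adj }.

Section Graphs.
Context {V : choiceType} (G : simple_graph V).

Definition neighbors (x : V) : set V := [set y | adj G x y].

Definition locally_finite : Prop := forall x, finite_set (neighbors x).

(* [fset_set] of an infinite set is empty, so this is the number of neighbors
   only when [neighbors x] is finite. *)
Definition degree (x : V) : nat := #|` fset_set (neighbors x)|.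

Definition bounded_degrees : Prop := exists D : nat, forall x, (degree x <= D)%N.

Definition connected_in (A : {fset V}) : Prop :=
  forall x y, x \in A -> y \in A ->
    exists p : seq V, [/\ path (adj G) x p, last x p = y & {subset p <= A}].

End Graphs.

Section RandomWalk.
Context {V : choiceType} (G : simple_graph V) (R : realType).
Context {d : measure_display} {Omega : measurableType d}.

Definition srw_trans (x y : V) : R :=
  if adj G x y then (degree G x)%:R^-1 else 0.

Definition follows (X : nat -> Omega -> V) (n : nat) (x : nat -> V) : set Omega :=
  [set w | forall i, (i <= n)%N -> X i w = x i].

(* [srw_step] is the Markov property in product form, so that no conditioning
   on null events is needed.  V carries no sigma-algebra: only the events
   {X_n = x} are required to be measurable, which is enough since G is locally
   finite and so X_n almost surely lies in a finite set. *)
Record is_srw (o : V) (P : probability Omega R) (X : nat -> Omega -> V) : Prop :=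
  IsSrw {
    srw_measurable : forall n x, measurable [set w | X n w = x];
    srw_start : P [set w | X 0%N w = o] = 1%E;
    srw_step : forall (x : nat -> V) n,
      P (follows X n.+1 x) = (P (follows X n x) * (srw_trans (x n) (x n.+1))%:E)%E }.

Definition walk_range (X : nat -> Omega -> V) (n : nat) (w : Omega) : {fset V} :=
  [fset X i w | i in iota 0 n.+1].

(* If V is uncountable, w |-> |R_n(w)| need not be measurable, but it coincides
   with a simple function on a measurable set of probability one, so the
   integral has its usual value. *)
Definition mean_range (P : probability Omega R) (X : nat -> Omega -> V) (n : nat)
  : \bar R := 'E_P[fun w => #|` walk_range X n w|%:R].

(* As [0^-1 = 0] and [ln 0 = 0], a set A of probability zero contributes 0. *)
Definition range_entropy (o : V) (P : probability Omega R)
    (X : nat -> Omega -> V) (n : nat) : \bar R :=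
  \esum_(A in [set A : {fset V} | connected_in G A /\ o \in A])
    (let p := fine (P [set w | walk_range X n w = A]) in p * ln p^-1)%:E.

Definition no_return (o : V) (X : nat -> Omega -> V) : set Omega :=
  [set w | forall n, (0 < n)%N -> X n w <> o].

Definition uniformly_transient (P : V -> probability Omega R)
    (X : nat -> Omega -> V) : Prop :=
  (0 < ereal_inf [set P o (no_return o X) | o in [set: V]])%E.

End RandomWalk.

(* Main.v *)
(** Let [delta] bound the escape probabilities from below and [D] the degrees.
  The number of distinct vertices among [X_0, ..., X_n] is at most [n + 1], so it
  suffices that the entropy grows linearly, and there are two steps.

  Entropy is at least the expected boundary.  If [R_n = A], then at the first visit
  of every vertex of [A] with a neighbour outside [A] the walk must step inside [A],
  so [P(R_n = A) <= (1 - 1/D)^(b - 1)], where [b] is the number of such vertices.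

  The expected boundary is linear.  Call an edge [{v, w}] two-way if from either end
  the walk avoids the other end forever with probability at least [1 - rho] (here
  [rho = 1 - delta / 2]).  Whichever end is visited first, the other one is then
  never visited with probability at least [1 - rho], and this makes the first end a
  boundary vertex.  Every vertex [u] has a neighbour [x] from which [u] is avoided
  with probability at least [delta]; if [{u, x}] is not two-way, reversibility makes
  [green x x / deg x] smaller than [green u u / deg u] by a factor [rho].  As this
  ratio lies between [1/D] and [1/delta], two-way edges are found within a bounded
  distance of every vertex, and the walk visits linearly many of them. *)
Require Import Defs.
From mathcomp Require Import all_boot all_order all_algebra finmap.
From mathcomp Require Import all_classical all_reals all_analysis.
From mathcomp Require Import ring lra.
Set Implicit Arguments.
Unset Strict Implicit.
Unset Printing Implicit Defensive.
Import Order.TTheory GRing.Theory Num.Theory.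
Import numFieldNormedType.Exports.
Local Open Scope classical_set_scope.
Local Open Scope ring_scope.

(** * The transition operator of the walk *)

Section Averaging.
Context (R : realType) (V : choiceType) (G : simple_graph V).
Context (lf : locally_finite G) (dg : forall x : V, (0 < degree G x)%N).
Implicit Types (f g : V -> R) (x y : V) (n m k : nat).

Definition nb x : {fset V} := fset_set (neighbors G x).

Lemma mem_nb x y : (y \in nb x) = adj G x y.
Proof. by rewrite in_fset_set//; apply/idP/idP; rewrite inE. Qed.

Lemma degree_gt0 x : 0 < (degree G x)%:R :> R.
Proof. by rewrite ltr0n. Qed.

Definition nb_mean f x : R := (degree G x)%:R^-1 * \sum_(y <- nb x) f y.

Local Notation avg := nb_mean.

Lemma eq_avg f g x : (forall y, adj G x y -> f y = g y) -> avg f x = avg g x.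
Proof.
move=> fg; congr (_ * _); apply: eq_big_seq => y; rewrite mem_nb; exact: fg.
Qed.

Lemma le_avg f g x : (forall y, adj G x y -> f y <= g y) -> avg f x <= avg g x.
Proof.
move=> fg; rewrite ler_pM2l ?invr_gt0 ?degree_gt0//.
rewrite big_seq [leRHS]big_seq; apply: ler_sum => y; rewrite mem_nb; exact: fg.
Qed.

Lemma avg_cst (c : R) x : avg (fun=> c) x = c.
Proof.
rewrite /nb_mean big_const_seq count_predT iter_addr_0 -[size _]/(degree G x).
by rewrite -[c *+ _]mulr_natr mulrCA mulVf ?mulr1// gt_eqF// degree_gt0.
Qed.

Lemma avgD f g x : avg (fun y => f y + g y) x = avg f x + avg g x.
Proof. by rewrite /nb_mean big_split mulrDr. Qed.

Lemma avgZ (c : R) f x : avg (fun y => c * f y) x = c * avg f x.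
Proof. by rewrite /nb_mean -mulr_sumr mulrCA. Qed.

Lemma avg_sum (I : Type) (r : seq I) (p : pred I) (F : I -> V -> R) x :
  avg (fun y => \sum_(i <- r | p i) F i y) x = \sum_(i <- r | p i) avg (F i) x.
Proof. by rewrite /nb_mean exchange_big /= -mulr_sumr. Qed.

Lemma avg_ge0 f x : (forall y, 0 <= f y) -> 0 <= avg f x.
Proof. by move=> f0; rewrite -(avg_cst 0 x); apply: le_avg. Qed.

Lemma avg_le1 f x : (forall y, f y <= 1) -> avg f x <= 1.
Proof. by move=> f1; rewrite -[leRHS](avg_cst 1 x); apply: le_avg. Qed.

Lemma le_avg_nb (D : nat) f x y : (degree G x <= D)%N -> (forall z, 0 <= f z) ->
  adj G x y -> D%:R^-1 * f y <= avg f x.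
Proof.
move=> xD f0 xy; apply: (@le_trans _ _ ((degree G x)%:R^-1 * f y)).
  by rewrite ler_wpM2r// lef_pV2 ?posrE ?degree_gt0 ?ltr0n ?(leq_trans (dg x))// ler_nat.
rewrite ler_pM2l ?invr_gt0 ?degree_gt0//.
rewrite (big_fsetD1 y) ?mem_nb//= lerDl; exact: sumr_ge0.
Qed.

End Averaging.

(** * Hitting probabilities and Green functions at finite horizons, and reversibility *)

Section Green.
Context (R : realType) (V : choiceType) (G : simple_graph V).
Context (lf : locally_finite G) (dg : forall x : V, (0 < degree G x)%N).
Implicit Types (x y : V) (n m k : nat).
Local Notation avg := (@nb_mean R V G).

(** Here and in [hit] and [green] the target [y] precedes the start [x], so that a partial
    application is a function of the start, to which [avg] applies. *)
Fixpoint step_prob k y x : R :=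
  if k is k'.+1 then avg (step_prob k' y) x else (x == y)%:R.

Fixpoint hit n y x : R :=
  if x == y then 1 else if n is n'.+1 then avg (hit n' y) x else 0.

Definition green n y x : R := \sum_(k < n.+1) step_prob k y x.

Lemma step_prob_ge0 k y x : 0 <= step_prob k y x.
Proof. elim: k x => [|k IH] x /=; [exact: ler0n|exact: avg_ge0]. Qed.

Lemma hit_self n y : hit n y y = 1.
Proof. by case: n => [|n] /=; rewrite eqxx. Qed.

Lemma hit_ge0 n y x : 0 <= hit n y x.
Proof.
by elim: n x => [|n IH] x /=; case: eqP => // _; exact: avg_ge0.
Qed.

Lemma hit_le1 n y x : hit n y x <= 1.
Proof.
by elim: n x => [|n IH] x /=; case: eqP => // _; exact: avg_le1.
Qed.

Lemma hitS n y x : hit n y x <= hit n.+1 y x.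
Proof.
elim: n x => [|n IH] x.
  by rewrite /=; case: eqP => // _; apply: avg_ge0 => // z; exact: (hit_ge0 0).
rewrite /=; case: eqP => // _; apply: le_avg => // z _; exact: IH.
Qed.

Lemma le_hit n m y x : (n <= m)%N -> hit n y x <= hit m y x.
Proof.
move=> /subnK <-; elim: (m - n)%N => // k IH.
by rewrite addSn (le_trans IH)// hitS.
Qed.

Lemma greenS n y x : green n.+1 y x = (x == y)%:R + avg (green n y) x.
Proof.
rewrite /green big_ord_recl; congr (_ + _).
by rewrite avg_sum.
Qed.

Lemma green0 y x : green 0 y x = (x == y)%:R.
Proof. by rewrite /green big_ord_recl big_ord0 addr0. Qed.

Lemma green_ge0 n y x : 0 <= green n y x.
Proof. by apply: sumr_ge0 => k _; exact: step_prob_ge0. Qed.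

Lemma le_green n m y x : (n <= m)%N -> green n y x <= green m y x.
Proof.
move=> /subnK <-; elim: (m - n)%N => // k IH.
rewrite (le_trans IH)// addSn /green [leRHS]big_ord_recr lerDl.
exact: step_prob_ge0.
Qed.

(** At the first visit to [y] at most [n] steps remain, so [green n y y] bounds the expected visits
    from then on. *)
Lemma green_le_hit n y x : green n y x <= hit n y x * green n y y.
Proof.
elim: n x => [|n IH] x.
  by rewrite /= !green0 eqxx mulr1; case: eqP.
have [->|xy] := eqVneq x y; first by rewrite hit_self mul1r.
rewrite greenS /= (negPf xy) add0r.
apply: (@le_trans _ _ (avg (fun z => green n.+1 y y * hit n y z) x)).
  apply: le_avg => // z _; rewrite (le_trans (IH z))// mulrC ler_wpM2r ?hit_ge0//.
  exact: le_green.
by rewrite avgZ mulrC.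
Qed.

(** If [y] is reached within [n] steps, at least [m] of the [n + m] steps remain. *)
Lemma hit_green_le n m y x : hit n y x * green m y y <= green (n + m) y x.
Proof.
elim: n x => [|n IH] x /=.
  by case: eqP => [->|_]; rewrite ?mul1r// mul0r green_ge0.
have [->|xy] := eqVneq x y; first by rewrite mul1r le_green// leq_addl.
rewrite addSn greenS (negPf xy) add0r mulrC -avgZ; apply: le_avg => // z _.
by rewrite mulrC.
Qed.

(** Decomposes by the last step; reversibility follows by playing this against the recursion, which
    uses the first. *)
Lemma step_probSr k y x :
  step_prob k.+1 y x = \sum_(z <- nb G y) step_prob k z x / (degree G z)%:R.
Proof.
elim: k x => [|k IH] x.
  rewrite /= {1}/nb_mean.
  have e (p : V -> R) (z0 : V) (A : {fset V}) :
      \sum_(z <- A) (z == z0)%:R * p z = (z0 \in A)%:R * p z0.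
    have [zA|zA] := boolP (z0 \in A).
      rewrite (big_fsetD1 z0)//= eqxx big_seq big1 ?addr0// => z.
      by rewrite !inE => /andP[/negPf ->]; rewrite mul0r.
    rewrite big_seq big1 ?mul0r// => z zA'.
    by case: eqP => [zz|_]; rewrite ?mul0r//; rewrite zz (negPf zA) in zA'.
  transitivity ((x \in nb G y)%:R * (degree G x)%:R^-1 : R); last first.
    rewrite -(e (fun z => (degree G z)%:R^-1)).
    by apply: eq_bigr => z _; rewrite eq_sym.
  rewrite mem_nb// adj_sym -mem_nb// mulrC; congr (_ * _).
  have /= e1 := e (fun=> 1) y (nb G x); rewrite mulr1 in e1; rewrite -e1.
  by apply: eq_bigr => z _; rewrite mulr1.
rewrite [LHS]/= -/(step_prob k.+1 y) (funext IH) avg_sum.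
apply: eq_bigr => z _ /=; rewrite [RHS]mulrC -avgZ; congr (avg _ x).
by apply/funext => w; rewrite mulrC.
Qed.

Lemma step_prob_rev k x y :
  (degree G x)%:R * step_prob k y x = (degree G y)%:R * step_prob k x y.
Proof.
elim: k x y => [|k IH] x y.
  by rewrite /= eq_sym; case: eqP => [->|]//; rewrite !mulr0.
rewrite step_probSr [in RHS]/= /nb_mean mulVKf ?gt_eqF ?degree_gt0//.
rewrite mulr_sumr; apply: eq_bigr => z _.
by rewrite mulrA IH mulrAC mulfV ?mul1r// gt_eqF ?degree_gt0.
Qed.

Lemma green_rev n x y :
  (degree G x)%:R * green n y x = (degree G y)%:R * green n x y.
Proof. by rewrite !mulr_sumr; apply: eq_bigr => k _; exact: step_prob_rev. Qed.

(* Both sides approximate the reversible quantity [deg x * green y x], so a vertex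
   [y] that [x] hits more easily than conversely has a smaller [green y y / deg y]. *)
Lemma hit_rev n m x y :
  (degree G x)%:R * (hit n y x * green m y y)
  <= (degree G y)%:R * (hit (n + m) x y * green (n + m) x x).
Proof.
apply: (@le_trans _ _ ((degree G x)%:R * green (n + m) y x)).
  by rewrite ler_pM2l ?degree_gt0// hit_green_le.
by rewrite green_rev ler_pM2l ?degree_gt0// green_le_hit.
Qed.

End Green.

(** * Time spent in a set of vertices *)

Section Occupation.
Context (R : realType) (V : choiceType) (G : simple_graph V).
Context (lf : locally_finite G) (dg : forall x : V, (0 < degree G x)%N).
Implicit Types (W : pred V) (x y : V) (n m k r : nat).
Local Notation avg := (@nb_mean R V G).

Fixpoint hit_set W n x : R :=
  if W x then 1 else if n is n'.+1 then avg (hit_set W n') x else 0.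

Fixpoint occ_prob W k x : R :=
  if k is k'.+1 then avg (occ_prob W k') x else (W x)%:R.

Lemma hit_set_ge0 W n x : 0 <= hit_set W n x.
Proof.
by elim: n x => [|n IH] x /=; case: (W x) => //; exact: avg_ge0.
Qed.

Lemma occ_prob_ge0 W k x : 0 <= occ_prob W k x.
Proof. elim: k x => [|k IH] x /=; [exact: ler0n|exact: avg_ge0]. Qed.

(** A path that meets [W] by time [r] spends at least one of the times [0, ..., r] there. *)
Lemma hit_set_le_occ W r x : hit_set W r x <= \sum_(k < r.+1) occ_prob W k x.
Proof.
elim: r x => [|r IH] x; first by rewrite big_ord_recl big_ord0 addr0 /=; case: (W x).
rewrite big_ord_recl /=; case: (W x) => /=.
  by rewrite lerDl; apply: sumr_ge0 => k _; rewrite avg_ge0// => y; exact: occ_prob_ge0.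
by rewrite add0r -avg_sum; apply: le_avg => // y _; exact: IH.
Qed.

Lemma occ_prob_shift W (c : R) r j x :
  (forall u, c <= \sum_(k < r) occ_prob W k u) ->
  c <= \sum_(k < r) occ_prob W (j + k) x.
Proof.
move=> cW; elim: j x => [|j IH] x //=.
by rewrite -avg_sum -[c in c <= _](avg_cst dg c x); apply: le_avg => // y _.
Qed.

(** Cut time into [m] blocks of length [r]; the hypothesis holds for every start, so by the Markov
    property each block contributes at least [c]. *)
Lemma occ_prob_linear W (c : R) r m x :
  (forall u, c <= \sum_(k < r) occ_prob W k u) ->
  m%:R * c <= \sum_(k < m * r) occ_prob W k x.
Proof.
move=> cW; elim: m => [|m IH]; first by rewrite mul0r mul0n big_ord0.
rewrite -addn1 mulnDl mul1n natrD mulrDl mul1r big_split_ord /=.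
by apply: lerD => //; exact: occ_prob_shift.
Qed.

(** Contains every position up to time [n], and so turns sums over a possibly infinite [V] into
    finite ones. *)
Fixpoint reach n x : {fset V} :=
  if n is n'.+1 then (x |` \bigcup_(y <- nb G x) reach n' y)%fset else [fset x]%fset.

Lemma reach_self n x : x \in reach n x.
Proof. by case: n => [|n] /=; rewrite !inE eqxx. Qed.

Lemma reach_nb n x y : adj G x y -> (reach n y `<=` reach n.+1 x)%fset.
Proof.
move=> xy; apply/fsubsetP => z zy /=; rewrite !inE; apply/orP; right.
by apply/bigfcupP; exists y; rewrite ?andbT ?mem_nb.
Qed.

Lemma occ_probE W n k x (S : {fset V}) : (k <= n)%N -> (reach n x `<=` S)%fset ->
  occ_prob W k x = \sum_(w <- S | W w) step_prob R G k w x.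
Proof.
elim: k n x => [|k IH] n x kn xS.
  have xS' : x \in S by rewrite (fsubsetP xS)// reach_self.
  rewrite /= big_mkcond (big_fsetD1 x)//= eqxx big_seq big1 ?addr0; first by case: (W x).
  by move=> z; rewrite !inE eq_sym => /andP[/negPf ->]; case: (W z).
case: n kn xS => // n kn xS /=; rewrite -avg_sum.
apply: eq_avg => // y xy; apply: (IH n) => //.
by apply: fsubset_trans xS; exact: reach_nb.
Qed.

End Occupation.

(** * Two-way edges near every vertex *)

Section TwoWay.
Context (R : realType) (V : choiceType) (G : simple_graph V).
Context (lf : locally_finite G) (dg : forall x : V, (0 < degree G x)%N).
Implicit Types (x y u v w : V) (n m k r : nat).
Local Notation avg := (@nb_mean R V G).
Context (D : nat) (degD : forall x, (degree G x <= D)%N).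
Context (delta : R) (delta_gt0 : 0 < delta).
Context (escape : forall n y, avg (hit R G n y) y < 1 - delta).

(** Each visit is followed by a return with probability below [1 - delta], so the number of visits
    is dominated by a geometric variable. *)
Lemma green_le_inv n y : green R G n y y <= delta^-1.
Proof.
apply: (@le_trans _ _ (green R G n.+1 y y)); first exact: le_green.
(* With the horizon [n.+1] on both sides, the inequality can be solved for [green]. *)
have e : green R G n.+1 y y <= 1 + (1 - delta) * green R G n.+1 y y.
  rewrite [leLHS]greenS eqxx lerD2l//.
  apply: (@le_trans _ _ (green R G n y y * avg (hit R G n y) y)).
    rewrite -avgZ; apply: le_avg => // z _; rewrite mulrC; exact: green_le_hit.
  rewrite mulrC; apply: ler_pM.
  - by apply: avg_ge0 => // z; exact: hit_ge0.
  - exact: green_ge0.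
  - exact/ltW/escape.
  - exact: le_green.
by rewrite -[delta^-1]mulr1 ler_pdivlMl// ; lra.
Qed.

(** If every neighbour hit [u] with probability at least [1 - delta], so would their average,
    against [escape]. *)
Lemma escaping_nb u : exists2 x, adj G u x & forall n, hit R G n u x <= 1 - delta.
Proof.
apply: contrapT => no.
have /choice[N HN] : forall x, exists n, adj G u x -> 1 - delta <= hit R G n u x.
  move=> x; apply: contrapT => nox; apply: no; exists x.
    by apply: contrapT => ux; apply: nox; exists 0%N.
  move=> n; rewrite leNgt; apply/negP => lt; apply: nox; exists n => _; exact: ltW.
(* The horizons depend on the neighbour; as [hit] is monotone in the horizon, their maximum serves
   all of them. *)
pose M := (\max_(x <- nb G u) N x)%N.
have := escape M u; rewrite ltNge => /negP; apply.
rewrite -[leLHS](avg_cst dg _ u); apply: le_avg => // x ux.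
apply: (le_trans (HN x ux)); apply: le_hit => //.
have xu : x \in nb G u by rewrite mem_nb.
by rewrite /M (big_rem x)//= leq_maxl.
Qed.

Definition two_way (rho : R) v w :=
  adj G v w /\ forall n, hit R G n v w <= rho /\ hit R G n w v <= rho.

Definition two_way_end (rho : R) : pred V := fun v => `[< exists w, two_way rho v w >].

Context (rho : R) (rho_gt0 : 0 < rho) (rho_le1 : rho <= 1).
Context (delta_rho : 1 - delta <= rho * rho).

(* If [u] is not the end of a two-way edge then, [x] being a neighbour that
   avoids [u] with probability at least [delta], [u] hits [x] with probability
   more than [rho], and by reversibility the bound on [green / deg] improves by a
   factor [rho] at [x].  As [green / deg >= 1/D], this stops after [r] steps. *)
Lemma hit_two_way r u (B : R) :
  (forall m, green R G m u u <= B * (degree G u)%:R) -> B * rho ^+ r * D%:R < 1 ->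
  D%:R^-1 ^+ r <= hit_set R G (two_way_end rho) r u.
Proof.
elim: r u B => [|r IH] u B uB lt1.
  rewrite expr0 mulr1 in lt1; have := uB 0%N; rewrite green0 eqxx => b1.
  have B0 : 0 <= B.
    have := degree_gt0 R dg u; have := lt_le_trans ltr01 b1.
    by move=> p q; move: p; rewrite pmulr_lgt0// => /ltW.
  have := lt_le_trans lt1 (le_trans b1 (ler_wpM2l B0 _)).
  by move=> /(_ D%:R); rewrite ltxx ler_nat degD => /(_ isT).
have D0 : 0 <= D%:R^-1 :> R by rewrite invr_ge0.
rewrite /=; case: ifPn => [_|/asboolP nW].
  rewrite exprn_ile1// invf_le1 ?ler1n ?ltr0n; first exact: leq_trans (dg u) (degD u).
  exact: leq_trans (dg u) (degD u).
have [x ux xu] := escaping_nb u.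
apply: (@le_trans _ _ (D%:R^-1 * hit_set R G (two_way_end rho) r x)); last first.
  by apply: le_avg_nb => // z; exact: hit_set_ge0.
rewrite exprS ler_wpM2l//; apply: (IH _ (rho * B)); last first.
  by move: lt1; rewrite exprS mulrA [B * rho]mulrC.
have rho1 : 1 - delta <= rho.
  by rewrite (le_trans delta_rho)// ler_piMr// ltW.
have [n un] : exists n, rho < hit R G n x u.
  apply: contrapT => no; apply: nW; exists x; split=> // n; split.
    exact: le_trans (xu n) rho1.
  by rewrite leNgt; apply/negP => lt; apply: no; exists n.
move=> m; have du := degree_gt0 R dg u; have dx := degree_gt0 R dg x.
have h := hit_rev R lf dg n m u x.
have h1 : (degree G u)%:R * (rho * green R G m x x)
    <= (degree G u)%:R * (hit R G n x u * green R G m x x).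
  by rewrite ler_pM2l// ler_wpM2r ?green_ge0// ltW.
(* Of the two factors [rho], one cancels against the lower bound [rho] in [h1], the other is the
   gain passed on to [x]. *)
have h2 : (degree G x)%:R * (hit R G (n + m) u x * green R G (n + m) u u)
    <= (degree G x)%:R * (rho * rho * (B * (degree G u)%:R)).
  rewrite ler_pM2l//; apply: ler_pM => //; first exact: hit_ge0.
    exact: green_ge0.
  exact: le_trans (xu _) delta_rho.
have := le_trans h1 (le_trans h h2).
rewrite (_ : (degree G x)%:R * _ = (degree G u)%:R * (rho * (rho * B * (degree G x)%:R))); last lra.
by rewrite ler_pM2l// ler_pM2l.
Qed.

End TwoWay.

(** * Expectations over finite paths *)

Section PathMean.
Context (R : realType) (V : choiceType) (G : simple_graph V).
Context (lf : locally_finite G) (dg : forall x : V, (0 < degree G x)%N).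
Implicit Types (x y : V) (n m k r : nat) (s p : seq V) (f g : seq V -> R).
Local Notation avg := (@nb_mean R V G).

(* A path is encoded as its starting point and the sequence of its later vertices. *)
Fixpoint paths n x : seq (seq V) :=
  if n is n'.+1 then [seq y :: s | y <- nb G x, s <- paths n' y] else [:: [::]].

Fixpoint path_wt x s : R :=
  if s is y :: s' then (degree G x)%:R^-1 * path_wt y s' else 1.

(** The expectation of [f] at the whole trajectory up to time [n], its start included. *)
Definition path_mean n f x : R :=
  \sum_(s <- paths n x) path_wt x s * f (x :: s).

Lemma mem_paths n x s : (s \in paths n x) = (size s == n) && path (adj G) x s.
Proof.
elim: n x s => [|n IH] x s /=; first by rewrite inE; case: s.
apply/allpairsPdep/idP => [[y [t [yx ty ->]]]|].
  by rewrite /= eqSS; move: yx ty; rewrite mem_nb// IH => -> /andP[-> ->].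
case: s => // y t; rewrite /= eqSS => /and3P[st xy pt]; exists y, t; split=> //.
  by rewrite mem_nb.
by rewrite IH st.
Qed.

Lemma paths_uniq n x : uniq (paths n x).
Proof.
elim: n x => [//|n IH] x /=; apply: allpairs_uniq_dep ; first exact: fset_uniq.
  by move=> y _; exact: IH.
by move=> [y s] [y' s'] _ _ /= [-> ->].
Qed.

Lemma path_wt_ge0 x s : 0 <= path_wt x s.
Proof. by elim: s x => //= y s IH x; rewrite mulr_ge0// invr_ge0. Qed.

Lemma path_mean0 f x : path_mean 0 f x = f [:: x].
Proof. by rewrite /path_mean big_seq1 mul1r. Qed.

Lemma path_meanS n f x :
  path_mean n.+1 f x = avg (path_mean n (fun p => f (x :: p))) x.
Proof.
rewrite /path_mean /nb_mean big_allpairs_dep /= mulr_sumr.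
apply: eq_bigr => y _; rewrite mulr_sumr; apply: eq_bigr => s _.
by rewrite mulrA.
Qed.

Lemma le_path_mean n f g x : (forall p, f p <= g p) ->
  path_mean n f x <= path_mean n g x.
Proof. by move=> fg; apply: ler_sum => s _; rewrite ler_wpM2l ?path_wt_ge0. Qed.

Lemma path_mean_cst n (c : R) x : path_mean n (fun=> c) x = c.
Proof.
elim: n x => [|n IH] x; first by rewrite path_mean0.
by rewrite path_meanS (funext IH) avg_cst.
Qed.

Lemma path_mean_ge0 n f x : (forall p, 0 <= f p) -> 0 <= path_mean n f x.
Proof. by move=> f0; rewrite -(path_mean_cst n 0 x); exact: le_path_mean. Qed.

Lemma path_meanZ n (c : R) f x :
  path_mean n (fun p => c * f p) x = c * path_mean n f x.
Proof. by rewrite /path_mean mulr_sumr; apply: eq_bigr => s _; rewrite mulrCA. Qed.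

Lemma path_meanB n f g x :
  path_mean n (fun p => f p - g p) x = path_mean n f x - path_mean n g x.
Proof. by rewrite /path_mean -sumrB; apply: eq_bigr => s _; rewrite mulrBr. Qed.

Lemma path_mean_sum n (I : Type) (r : seq I) (P : pred I) (F : I -> seq V -> R) x :
  path_mean n (fun p => \sum_(i <- r | P i) F i p) x =
  \sum_(i <- r | P i) path_mean n (F i) x.
Proof.
by rewrite /path_mean exchange_big /=; apply: eq_bigr => s _; rewrite mulr_sumr.
Qed.

Lemma hit_path_mean n y x : hit R G n y x = path_mean n (fun p => (y \in p)%:R) x.
Proof.
elim: n x => [|n IH] x.
  by rewrite path_mean0 /= inE eq_sym; case: eqP.
rewrite path_meanS /=; case: eqP => [<-|/eqP xy].
  rewrite -[LHS](avg_cst dg 1 x); congr (avg _ x); apply/funext => z.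
  rewrite -[LHS](path_mean_cst n 1 z); congr (path_mean _ _ _).
  by apply/funext => p; rewrite inE eqxx.
congr (avg _ x); apply/funext => z; rewrite IH; congr (path_mean _ _ _).
by apply/funext => p; rewrite inE eq_sym (negPf xy).
Qed.

(** Induct until the first visit to [{v, w}]. There the left side is at most [1 - rho], and the end
    just visited remains the only one with at least that probability. *)
Lemma path_mean_two_way (rho : R) n x v w : rho <= 1 ->
  two_way G rho v w ->
  (1 - rho) * hit R G n v x <= path_mean n (fun p => ((v \in p) != (w \in p))%:R) x.
Proof.
move=> rho1 [vw hrho]; have vNw : v != w.
  by apply/eqP => e; move: vw; rewrite e (adj_irr G).
have start n' z z' (h : hit R G n' z' z <= rho) : z != z' ->
    1 - rho <= path_mean n' (fun p => ((z \in p) != (z' \in p))%:R) z.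
  move=> zz'; apply: (@le_trans _ _ (1 - hit R G n' z' z)); first lra.
  have -> : 1 - hit R G n' z' z = path_mean n' (fun p => 1 - (z' \in p)%:R) z.
    by rewrite path_meanB path_mean_cst hit_path_mean.
  apply: ler_sum => s _; rewrite ler_wpM2l ?path_wt_ge0//.
  by rewrite mem_head; case: (_ \in _); rewrite ?subrr ?subr0.
elim: n x => [|n IH] x.
  rewrite path_mean0 /= !inE ![_ == x]eq_sym.
  have [->|_] := eqVneq x v; last by rewrite mulr0; case: eqP.
  rewrite mulr1 (negPf vNw) /=.
  (* At horizon 0 the two-way bound reads [0 <= rho], which is what [1 - rho <= 1] requires. *)
  by have [_ /=] := hrho 0%N; rewrite (negPf vNw) => ?; lra.
have [->|xv] := eqVneq x v.
  by rewrite hit_self mulr1; apply: start => //; have [] := hrho n.+1.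
have [->|xw] := eqVneq x w.
  apply: (@le_trans _ _ (1 - rho)).
    by rewrite -[leRHS]mulr1 ler_wpM2l ?hit_le1// subr_ge0.
  have -> : (fun p => ((v \in p) != (w \in p))%:R) =
      (fun p => ((w \in p) != (v \in p))%:R) :> (seq V -> R).
    by apply/funext => p; rewrite eq_sym.
  by apply: start; rewrite 1?eq_sym//; have [] := hrho n.+1.
rewrite path_meanS /= (negPf xv) -avgZ; apply: le_avg => // z _.
rewrite (le_trans (IH z))//; apply: le_path_mean => p.
by rewrite !inE ![_ == x]eq_sym (negPf xv) (negPf xw).
Qed.

(** * The inner boundary, and a lower bound on entropy in terms of it *)

Definition vset (p : seq V) : {fset V} := [fset y in p]%fset.

Definition inner_boundary (A : {fset V}) : {fset V} :=
  [fset y in A | has (fun z => z \notin A) (nb G y)]%fset.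

Lemma inner_boundaryP (A : {fset V}) y :
  reflect (y \in A /\ exists2 z, adj G y z & z \notin A) (y \in inner_boundary A).
Proof.
rewrite !inE; apply: (iffP andP) => -[yA].
  by move=> /hasP[z]; rewrite mem_nb// => yz zA; split=> //; exists z.
by move=> [z yz zA]; split=> //; apply/hasP; exists z; rewrite ?mem_nb.
Qed.

(** Charge each split edge to its end in [A], an inner boundary vertex [b]. Then [w] is [b] or a
    neighbour of [b], whence the factor [D.+1]. *)
Lemma split_edges_le_boundary (D : nat) (degD : forall x, (degree G x <= D)%N)
    (W : pred V) (sigma : V -> V) (S A : {fset V}) :
  (forall w, W w -> adj G w (sigma w)) ->
  (\sum_(w <- S | W w) ((w \in A) != (sigma w \in A))
     <= D.+1 * #|` inner_boundary A|)%N.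
Proof.
move=> Wsigma.
have cnt (T : {fset V}) : (\sum_(w <- S) (w \in T) <= #|` T|)%N.
  apply: (@leq_trans (count (mem T) S)).
    by rewrite -sum1_count [leqRHS]big_mkcond leq_sum// => w _ /=; case: (w \in T).
  rewrite -size_filter uniq_leq_size ?filter_uniq ?fset_uniq// => w.
  by rewrite mem_filter => /andP[].
apply: (@leq_trans (\sum_(w <- S) \sum_(b <- inner_boundary A) (w \in b |` nb G b)%fset)).
  rewrite big_mkcond; apply: leq_sum => w _; case: ifP => // /Wsigma ws.
  have [wA|wA] := boolP (w \in A); have [sA|sA] := boolP (sigma w \in A) => //=.
    have wb : w \in inner_boundary A by apply/inner_boundaryP; split=> //; exists (sigma w).
    by rewrite (big_rem w)//= !inE eqxx.
  have wb : sigma w \in inner_boundary A.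
    by apply/inner_boundaryP; split=> //; exists w; rewrite // adj_sym.
  by rewrite (big_rem (sigma w))//= !inE mem_nb// adj_sym ws orbT.
rewrite exchange_big /=.
apply: (@leq_trans (\sum_(b <- inner_boundary A) D.+1)%N).
  apply: leq_sum => b _; apply: leq_trans (cnt _) _.
  by rewrite cardfsU1; exact: leq_add (leq_b1 _) (degD b).
by rewrite big_const_seq count_predT iter_addn_0.
Qed.

(** [S] holds the vertices still to be covered. The step after the first visit to each must land in
    [A], at a cost of [kappa]; the last one covered may end the path, with no step after it, hence
    the predecessor. *)
Lemma prob_cover_le (kappa : R) n x (S A : {fset V}) : 0 <= kappa <= 1 ->
  (forall y, y \in S -> avg (fun z => (z \in A)%:R) y <= kappa) ->
  path_mean n (fun p => (all (mem A) p && all (mem p) S)%:R) x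
    <= kappa ^+ #|` S|.-1.
Proof.
move=> /andP[k0 k1]; elim: n x S => [|n IH] x S SA.
  rewrite path_mean0; have [/fsubsetP Sx|nSx] := boolP (S `<=` [fset x])%fset.
    have : (#|` S| <= 1)%N by rewrite -(cardfs1 x); apply/fsubset_leq_card/fsubsetP.
    by case: #|` S| => [|[|]]// _; rewrite expr0; case: (_ && _).
  rewrite (_ : all (mem [:: x]) S = false) ?andbF ?exprn_ge0//.
  apply: contraNF nSx => /allP h; apply/fsubsetP => y /h.
  by rewrite !inE.
have [S1|S2] := leqP #|` S| 1.
  rewrite (_ : _.-1 = 0%N) ?expr0; last by case: #|` S| S1 => [|[|]].
  rewrite -[leRHS](path_mean_cst n.+1 1 x); apply: le_path_mean => p.
  by case: (_ && _).
rewrite path_meanS; have [xS|xS] := boolP (x \in S); last first.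
  rewrite -[leRHS](avg_cst dg _ x); apply: le_avg => // y _.
  apply: le_trans (IH y S SA); apply: le_path_mean => p; rewrite ler_nat.
  case: (boolP (_ && _)) => // /andP[/= /andP[_ ->] /allP h] /=.
  rewrite lt0b; apply/allP => z zS; have := h _ zS; rewrite /= inE => /orP[/eqP zx|//].
  by rewrite -zx zS in xS.
have cS : #|` S| = #|` (S `\ x)%fset|.+1 by rewrite (cardfsD1 x) xS.
have SA' y : y \in (S `\ x)%fset -> avg (fun z => (z \in A)%:R) y <= kappa.
  by rewrite !inE => /andP[_]; exact: SA.
have -> : #|` S|.-1 = #|` (S `\ x)%fset|.-1.+1.
  by rewrite cS /= prednK//; move: S2; rewrite cS.
rewrite exprSr.
apply: (@le_trans _ _ (avg (fun y => kappa ^+ #|` (S `\ x)%fset|.-1 * (y \in A)%:R) x)).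
  apply: le_avg => // y _; have [yA|yA] := boolP (y \in A); last first.
    rewrite mulr0 -(path_mean_cst n 0 y); apply: ler_sum => s _.
    by rewrite /= (negPf yA) andbF.
  rewrite mulr1; apply: le_trans (IH y _ SA'); apply: le_path_mean => p; rewrite ler_nat.
  case: (boolP (_ && _)) => // /andP[/= /andP[_ ->] /allP h] /=.
  rewrite lt0b; apply/allP => z; rewrite !inE => /andP[zx zS]; have := h _ zS.
  by rewrite /= inE (negPf zx).
by rewrite avgZ ler_wpM2l ?exprn_ge0// SA.
Qed.

(** A path with range [A] stays in [A] and covers its inner boundary, each vertex of which has a
    neighbour outside [A]; so [kappa] is [1 - 1/D]. *)
Lemma prob_range_le (D : nat) (degD : forall x, (degree G x <= D)%N) n x (A : {fset V}) :
  path_mean n (fun p => (vset p == A)%:R) x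
    <= (1 - D%:R^-1) ^+ #|` inner_boundary A|.-1.
Proof.
have D0 : 1 <= D%:R :> R by rewrite ler1n (leq_trans (dg x)).
apply: le_trans (prob_cover_le n x (S := inner_boundary A) (A := A) _ _).
- apply: le_path_mean => p; rewrite ler_nat; case: eqP => // <-.
  rewrite lt0b; apply/andP; split; apply/allP => y /=; first by rewrite !inE.
  by rewrite !inE => /andP[].
- have D1 : 0 < D%:R :> R by exact: lt_le_trans D0.
  by rewrite subr_ge0 invf_le1// D0 lerBlDr lerDl invr_ge0 ltW.
move=> y /inner_boundaryP[_ [z yz zA]].
have : D%:R^-1 <= avg (fun z => (z \notin A)%:R) y.
  rewrite -[leLHS]mulr1 -[X in _ * X]/(true%:R) -zA.
  by apply: (le_avg_nb lf dg (degD y) _ yz) => w; exact: ler0n.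
have : avg (fun z => (z \in A)%:R) y + avg (fun z => (z \notin A)%:R) y = 1.
  rewrite -avgD -[RHS](avg_cst dg 1 y); congr (avg _ y); apply/funext => w.
  by case: (w \in A); rewrite ?addr0 ?add0r.
lra.
Qed.

(** When [p > 0], [prob_range_le] bounds [ln p^-1] below by [L] times the boundary size minus one;
    this is averaged over the law of the range. *)
Lemma sum_entropy_ge (D : nat) (degD : forall x, (degree G x <= D)%N) n x :
  (1 < D)%N ->
  ln (1 - D%:R^-1)^-1 *
    (path_mean n (fun p => #|` inner_boundary (vset p)|%:R) x - 1)
  <= \sum_(A <- undup [seq vset (x :: s) | s <- paths n x])
       (let p := path_mean n (fun p => (vset p == A)%:R) x in p * ln p^-1).
Proof.
move=> D1; set L := ln _; set RS := undup _.
have D2 : 2 <= D%:R :> R by rewrite ler_nat.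
have Dinv : D%:R^-1 <= 2^-1 :> R by rewrite lef_pV2 ?posrE//; lra.
have Dinv0 : 0 < D%:R^-1 :> R by rewrite invr_gt0; lra.
have kappa0 : 0 < 1 - D%:R^-1 :> R by lra.
have L0 : 0 <= L by rewrite ln_ge0// invf_ge1//; lra.
have RSmem s : s \in paths n x -> vset (x :: s) \in RS.
  by move=> sp; rewrite mem_undup; apply/mapP; exists s.
apply: (@le_trans _ _ (\sum_(A <- RS) L *
    (path_mean n (fun p => (vset p == A)%:R) x * (#|` inner_boundary A|%:R - 1)))).
  rewrite -mulr_sumr ler_wpM2l// -[X in _ - X](path_mean_cst n 1 x) -path_meanB.
  (* Path by path, the only nonzero indicator is that of the path's own range. *)
  under [leRHS]eq_bigr => A _ do rewrite /path_mean mulr_suml.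
  rewrite exchange_big /= [leLHS]/path_mean [leLHS]big_seq [leRHS]big_seq.
  apply: ler_sum => s sp.
  under [leRHS]eq_bigr => A _ do rewrite -mulrA.
  rewrite -mulr_sumr ler_wpM2l ?path_wt_ge0//.
  rewrite (bigD1_seq (vset (x :: s))) ?undup_uniq ?RSmem//= eqxx mul1r lerDl.
  by apply: sumr_ge0 => A; rewrite eq_sym => /negPf ->; rewrite mul0r.
apply: ler_sum => A _ /=; set q := path_mean _ _ _.
have q0 : 0 <= q by apply: path_mean_ge0 => p; exact: ler0n.
have [->|qN0] := eqVneq q 0; first by rewrite !mul0r mulr0.
have q_gt0 : 0 < q by rewrite lt_def qN0.
rewrite mulrCA ler_wpM2l//.
apply: (@le_trans _ _ (#|` inner_boundary A|.-1%:R * L)).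
  (* For an empty boundary the predecessor is [0] while the real difference is [-1]. *)
  rewrite mulrC ler_wpM2r//; case: #|` _| => [|k]; first by rewrite sub0r lerN10.
  by rewrite /= -natr1; lra.
rewrite /L !lnV ?posrE// mulrN lerN2 mulr_natl -lnXn// ler_ln ?posrE ?exprn_gt0//.
exact: prob_range_le.
Qed.

End PathMean.

(** * Linear growth of the expected inner boundary *)

Section MeanBoundary.
Context (R : realType) (V : choiceType) (G : simple_graph V).
Context (lf : locally_finite G) (dg : forall x : V, (0 < degree G x)%N).
Context (D : nat) (degD : forall x, (degree G x <= D)%N).
Context (delta : R) (delta_gt0 : 0 < delta).
Context (escape : forall n y, nb_mean G (hit R G n y) y < 1 - delta).
Context (rho : R) (rho_gt0 : 0 < rho) (rho_le1 : rho <= 1).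
Context (delta_rho : 1 - delta <= rho * rho).

(** The [m] blocks of [r.+1] times give expected occupation at least [m / D^r] of two-way ends. Each
    end absorbs at most [delta^-1] visits once hit, and splits its edge with probability at least
    [1 - rho] times that of being hit; split edges are charged to the boundary. *)
Lemma mean_boundary_ge r m n x :
  delta^-1 * rho ^+ r * D%:R < 1 -> (m * r.+1 <= n.+1)%N ->
  (1 - rho) * (delta * (m%:R * D%:R^-1 ^+ r))
  <= D.+1%:R * path_mean G n (fun p => #|` inner_boundary G (vset p)|%:R) x.
Proof.
move=> small mn; set W := two_way_end G rho.
(* One partner is fixed for each two-way end; elsewhere [sigma] is arbitrary. *)
have /choice[sigma Hsigma] : forall v, exists w, W v -> two_way G rho v w.
  move=> v; have [/asboolP[w vw]|Wv] := boolP (W v); first by exists w.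
  by exists v.
set S := reach G n x.
have occ u : D%:R^-1 ^+ r <= \sum_(k < r.+1) occ_prob R G W k u.
  apply: le_trans (hit_set_le_occ R lf dg W r u).
  (* The initial [B] is [delta^-1], since degrees are at least 1. *)
  apply: (hit_two_way lf dg degD escape rho_gt0 rho_le1 delta_rho _ small).
  move=> k; rewrite (le_trans (green_le_inv lf dg delta_gt0 escape k u))//.
  by rewrite ler_peMr ?ler1n ?dg// invr_ge0 ltW.
have occ_hit : delta * (m%:R * D%:R^-1 ^+ r) <= \sum_(w <- S | W w) hit R G n w x.
  rewrite -ler_pdivlMl// mulr_sumr.
  apply: (le_trans (occ_prob_linear lf dg m x occ)).
  apply: (@le_trans _ _ (\sum_(k < n.+1) occ_prob R G W k x)).
    rewrite -(subnKC mn) big_split_ord /= lerDl; apply: sumr_ge0 => k _.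
    exact: occ_prob_ge0.
  rewrite (eq_bigr (fun k : 'I_n.+1 => \sum_(w <- S | W w) step_prob R G k w x)); last first.
    by move=> k _; apply: (occ_probE R lf W (n := n)) => //; rewrite -ltnS.
  rewrite exchange_big /=; apply: ler_sum => w _.
  apply: (le_trans (green_le_hit R lf dg n w x)).
  by rewrite mulrC ler_wpM2r ?hit_ge0// green_le_inv.
apply: (@le_trans _ _ ((1 - rho) * \sum_(w <- S | W w) hit R G n w x)).
  by rewrite ler_wpM2l// subr_ge0.
rewrite mulr_sumr -path_meanZ.
apply: (@le_trans _ _ (\sum_(w <- S | W w)
    path_mean G n (fun p => ((w \in p) != (sigma w \in p))%:R) x)).
  by apply: ler_sum => w Ww; apply: path_mean_two_way => //; exact: Hsigma.
rewrite -path_mean_sum; apply: le_path_mean => p.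
rewrite -natr_sum -natrM ler_nat.
have := @split_edges_le_boundary _ _ lf D degD W sigma S (vset p).
move/(_ (fun w Ww => (Hsigma w Ww).1)); apply: leq_trans.
by apply/eq_leq/eq_bigr => w _; rewrite !inE.
Qed.

End MeanBoundary.

(** * Transfer from paths to the walk [X] *)

Section Law.
Context (R : realType) (V : choiceType) (G : simple_graph V).
Context (lf : locally_finite G) (dg : forall x : V, (0 < degree G x)%N).
Context {d : measure_display} {Omega : measurableType d}.
Context (o : V) (P : probability Omega R) (X : nat -> Omega -> V).
Context (srw : is_srw G o P X).

Lemma measurable_at n x : measurable [set w | X n w = x].
Proof. by case: srw. Qed.

(** [follows] takes an infinite sequence; for [size s = n] the default [o] past the end is never
    read. *)
Definition path_event n s : set Omega := follows X n (nth o (o :: s)).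

Lemma measurable_follows n x : measurable (follows X n x).
Proof.
rewrite (_ : follows X n x = \bigcap_(i in `I_n.+1) [set w | X i w = x i]).
  by apply: fin_bigcap_measurable => // i _; exact: measurable_at.
by apply/seteqP; split => w.
Qed.

Lemma prob_follows n x : x 0%N = o ->
  P (follows X n x) = (\prod_(i < n) srw_trans G R (x i) (x i.+1))%:E.
Proof.
move=> x0; elim: n => [|n IH].
  rewrite big_ord0 -(srw_start srw); congr (P _); apply/seteqP; split => w /=.
    by move=> /(_ 0%N isT); rewrite x0.
  by move=> X0 [|]// _; rewrite X0.
by rewrite (srw_step srw) IH big_ord_recr.
Qed.

Lemma path_wtE y s : path (adj G) y s ->
  path_wt R G y s =
    \prod_(i < size s) srw_trans G R (nth o (y :: s) i) (nth o (y :: s) i.+1).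
Proof.
elim: s y => [|z s IH] y /=; first by rewrite big_ord0.
by move=> /andP[yz zs]; rewrite big_ord_recl /= IH// /srw_trans yz.
Qed.

Lemma prob_path_event n s : s \in paths G n o ->
  P (path_event n s) = (path_wt R G o s)%:E.
Proof.
by rewrite mem_paths// => /andP[/eqP <- os]; rewrite /path_event prob_follows// path_wtE.
Qed.

Definition paths_event n (L : seq (seq V)) : set Omega :=
  [set w | exists2 s, s \in L & path_event n s w].

Lemma paths_event_cons n s L :
  paths_event n (s :: L) = path_event n s `|` paths_event n L.
Proof.
apply/seteqP; split => w /=.
  by move=> [t]; rewrite inE => /orP[/eqP ->|tL] tw; [left|right; exists t].
move=> [sw|[t tL tw]]; first by exists s => //; rewrite inE eqxx.
by exists t => //; rewrite inE tL orbT.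
Qed.

Lemma measurable_paths_event n L : measurable (paths_event n L).
Proof.
elim: L => [|s L IH].
  by rewrite (_ : paths_event n [::] = set0)//; apply/seteqP; split => w [].
by rewrite paths_event_cons; apply: measurableU => //; exact: measurable_follows.
Qed.

Lemma path_event_inj n s t w : size s = n -> size t = n ->
  path_event n s w -> path_event n t w -> s = t.
Proof.
move=> sn tn sw tw; apply: (@eq_from_nth _ o); rewrite ?sn ?tn// => i ilt.
by have := sw i.+1 ilt; rewrite tw.
Qed.

(** Events of distinct paths of length [n] are disjoint, so their probabilities add up. *)
Lemma prob_paths_event n (Q : pred (seq V)) :
  P (paths_event n [seq s <- paths G n o | Q (o :: s)])
  = (path_mean G n (fun p => (Q p)%:R) o)%:E.
Proof.
rewrite /path_mean; transitivity
    (\sum_(s <- paths G n o | Q (o :: s)) path_wt R G o s)%:E; last first.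
  congr (_%:E); rewrite big_mkcond; apply: eq_bigr => s _.
  by case: (Q _); rewrite ?mulr1 ?mulr0.
rewrite -big_filter; have : {subset [seq s <- paths G n o | Q (o :: s)] <= paths G n o}.
  by move=> s; rewrite mem_filter => /andP[].
have : uniq [seq s <- paths G n o | Q (o :: s)] by rewrite filter_uniq ?paths_uniq.
elim: [seq s <- _ | _] => [_ _|s L IH /= /andP[sL uL] sub].
  rewrite big_nil (_ : paths_event n [::] = set0) ?measure0//.
  by apply/seteqP; split => w [].
have sizes t : t \in s :: L -> size t = n.
  by move/sub; rewrite mem_paths// => /andP[/eqP].
rewrite paths_event_cons measureU.
- rewrite big_cons EFinD; congr (_ + _)%E.
    by apply: prob_path_event; rewrite sub// inE eqxx.
  by apply: IH => // t tL; apply: sub; rewrite inE tL orbT.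
- exact: measurable_follows.
- exact: measurable_paths_event.
apply/seteqP; split => w //= [sw [t tL tw]]; move: sL.
by rewrite (path_event_inj (sizes _ _) (sizes _ _) sw tw) ?tL// inE ?eqxx ?tL ?orbT.
Qed.

Lemma walk_rangeP n w y :
  reflect (exists2 i, (i <= n)%N & y = X i w) (y \in walk_range X n w).
Proof.
apply: (iffP (imfsetP _ _ _ _)) => -[i].
  by rewrite [_ \in _]mem_iota add0n ltnS => /= ilt ->; exists i.
by move=> ilt ->; exists i; rewrite // [_ \in _]mem_iota add0n ltnS.
Qed.

Lemma path_event_range n s w : size s = n -> path_event n s w ->
  walk_range X n w = vset (o :: s).
Proof.
move=> sn sw; apply/fsetP => y; rewrite [RHS]in_fset /=; apply/walk_rangeP/idP.
  by move=> [i ilt ->]; rewrite sw// mem_nth//= sn ltnS.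
move=> yos; have idx : (index y (o :: s) <= n)%N.
  by rewrite -ltnS -sn -[(size s).+1]/(size (o :: s)) index_mem.
by exists (index y (o :: s)); rewrite ?sw ?nth_index.
Qed.

(** The event is built from the events [X i w = a] by finite unions and intersections. *)
Lemma measurable_range n (A : {fset V}) : measurable [set w | walk_range X n w = A].
Proof.
rewrite (_ : [set w | _] =
  (\bigcap_(i in `I_n.+1) \bigcup_(a in [set` A]) [set w | X i w = a]) `&`
  (\bigcap_(a in [set` A]) \bigcup_(i in `I_n.+1) [set w | X i w = a])).
  apply: measurableI; apply: fin_bigcap_measurable => // i _;
    by apply: fin_bigcup_measurable => // a _; exact: measurable_at.
apply/seteqP; split => w /=.
  move=> <-; split => [i ilt|a /walk_rangeP[i ilt ->]] /=; last by exists i.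
  by exists (X i w) => //=; apply/walk_rangeP; exists i.
move=> [XA AX]; apply/fsetP => y; apply/walk_rangeP/idP => [[i ilt ->]|yA].
  by have [a aA ->] := XA i ilt.
by have [i ilt iy] := AX y yA; exists i.
Qed.

Lemma prob_range n (A : {fset V}) :
  P [set w | walk_range X n w = A] =
  (path_mean G n (fun p => (vset p == A)%:R) o)%:E.
Proof.
pose Q := fun p : seq V => vset p == A.
rewrite -(prob_paths_event n Q); apply/eqP; rewrite eq_le; apply/andP; split; last first.
  apply: le_measure; rewrite ?inE; [exact: measurable_paths_event|exact: measurable_range|].
  move=> w [s]; rewrite mem_filter mem_paths// => /and3P[/eqP <- /eqP sn _] sw /=.
  exact: path_event_range.
have mall := measurable_paths_event n (paths G n o).
(* The paths of [G] from [o] carry total mass 1, so the other trajectories form a null event. *)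
have Pall : P (~` paths_event n (paths G n o)) = 0%E.
  rewrite probability_setC//.
  have := prob_paths_event n predT; rewrite filter_predT => ->.
  by rewrite (path_mean_cst dg) subee.
have -> : P (paths_event n [seq s <- paths G n o | Q (o :: s)]) =
    (P (paths_event n [seq s <- paths G n o | Q (o :: s)])
     + P (~` paths_event n (paths G n o)))%E by rewrite Pall adde0.
apply: (@le_trans _ _ (P (paths_event n [seq s <- paths G n o | Q (o :: s)] `|`
    ~` paths_event n (paths G n o)))); last first.
  by apply: measureU2; [exact: measurable_paths_event|exact: measurableC].
apply: le_measure; rewrite ?inE; first exact: measurable_range.
  by apply: measurableU; [exact: measurable_paths_event|exact: measurableC].
move=> w /= wA; have [[s sp sw]|] := pselect (paths_event n (paths G n o) w); last by right.
left; exists s => //; rewrite mem_filter sp andbT /Q -wA eq_sym; apply/eqP.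
by apply: path_event_range sw; move: sp; rewrite mem_paths// => /andP[/eqP].
Qed.

Lemma prob_no_return_le n :
  (P (no_return o X) <= (1 - nb_mean G (hit R G n o) o)%:E)%E.
Proof.
(* [behead] drops time 0, leaving the returns at times [1, ..., n.+1]. *)
pose Q := fun p : seq V => o \in behead p.
have -> : nb_mean G (hit R G n o) o = path_mean G n.+1 (fun p => (Q p)%:R) o.
  rewrite path_meanS; congr (nb_mean _ _ o); apply/funext => y.
  exact: hit_path_mean.
rewrite EFinB -prob_paths_event -probability_setC; last exact: measurable_paths_event.
apply: le_measure; rewrite ?inE.
- rewrite (_ : no_return o X = \bigcap_(k in [set k | (0 < k)%N]) ~` [set w | X k w = o]).
    by apply: bigcap_measurable => [|k _]; [exists 1%N|apply: measurableC; exact: measurable_at].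
  by apply/seteqP; split => w /=.
- by apply: measurableC; exact: measurable_paths_event.
move=> w nr [s]; rewrite mem_filter mem_paths// => /and3P[os /eqP sn _] sw.
rewrite /Q /= in os.
apply: (nr (index o s).+1) => //; rewrite sw; first by rewrite /= nth_index.
by rewrite -sn index_mem.
Qed.

Lemma mean_range_le n : (mean_range P X n <= n.+1%:R%:E)%E.
Proof.
rewrite /mean_range -(expectation_cst P) unlock.
(* As a supremum over simple functions below the integrand, the integral is monotone even for a
   non-measurable integrand. *)
rewrite !ge0_integralTE//; last by move=> w; rewrite lee_fin.
apply: le_ereal_sup => _ [h hf <-]; exists h => //= w.
apply: (le_trans (hf w)); rewrite lee_fin ler_nat.
rewrite -[leqRHS](size_iota 0) -(size_map (X^~ w)).
apply: uniq_leq_size => [|y /walk_rangeP[i ilt ->]]; first exact: fset_uniq.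
by apply: map_f; rewrite mem_iota.
Qed.

Lemma mean_range_ge0 n : (0 <= mean_range P X n)%E.
Proof. by rewrite /mean_range unlock; apply: integral_ge0 => w _; rewrite lee_fin. Qed.

Lemma mem_vset (p : seq V) y : (y \in vset p) = (y \in p).
Proof. by rewrite in_fset. Qed.

(** Any two vertices are joined through [y]: back along the path by symmetry of [adj], then
    forward. *)
Lemma path_connected_in y s : path (adj G) y s -> connected_in G (vset (y :: s)).
Proof.
pose joined (A : {fset V}) u v :=
  exists p, [/\ path (adj G) u p, last u p = v & {subset p <= A}].
have joined_sym A u v : u \in A -> joined A u v -> joined A v u.
  move=> uA [p [up <- pA]]; exists (rev (belast u p)); split.
  - rewrite -rev_path in up.
    by rewrite (eq_path (e' := fun a b => adj G b a))// => a b; exact: adj_sym.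
  - by case: p {up pA} => //= z p; rewrite rev_cons last_rcons.
  - by move=> z; rewrite mem_rev => /mem_belast; rewrite inE => /orP[/eqP ->|/pA].
have joined_head : forall t u, path (adj G) u t -> forall v, v \in u :: t ->
    joined (vset (u :: t)) u v.
  move=> t u ut v; rewrite inE => /orP[/eqP ->|vt]; first by exists [::].
  case/splitPr: vt ut => t1 t2 ut; exists (rcons t1 v); split.
  - by move: ut; rewrite -cat_rcons cat_path => /andP[].
  - by rewrite last_rcons.
  - move=> z; rewrite !mem_vset mem_rcons !inE mem_cat inE.
    by case/orP => ->; rewrite ?orbT.
move=> ys u v; rewrite !mem_vset => us vs.
have yA : y \in vset (y :: s) by rewrite mem_vset mem_head.
have [p [up pu pA]] := joined_sym _ _ _ yA (joined_head _ _ ys _ us).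
have [q [yq qv qA]] := joined_head _ _ ys _ vs.
exists (p ++ q); split; first by rewrite cat_path up pu.
  by rewrite last_cat pu.
by move=> z; rewrite mem_cat => /orP[/pA|/qA].
Qed.

(** The infinite sum dominates its finite partial sums, here the one over the ranges of paths of
    length [n]. *)
Lemma range_entropy_ge (D : nat) n : (forall x, (degree G x <= D)%N) -> (1 < D)%N ->
  ((ln (1 - D%:R^-1)^-1 *
    (path_mean G n (fun p => #|` inner_boundary G (vset p)|%:R) o - 1))%:E
  <= range_entropy G o P X n)%E.
Proof.
move=> degD D1.
apply: esum_ge; exists [set` undup [seq vset (o :: s) | s <- paths G n o]].
  split; first exact: finite_seq.
  move=> A /=; rewrite mem_undup => /mapP[s]; rewrite mem_paths// => /andP[_ os] ->.
  by split; [exact: path_connected_in|rewrite mem_vset mem_head].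
rewrite -fsbig_seq ?undup_uniq// sumEFin lee_fin.
apply: (le_trans (sum_entropy_ge R lf dg degD n o D1)).
by apply: ler_sum => A _; rewrite prob_range.
Qed.

End Law.

(** * Constants and passage to the limit *)

Lemma limn_einf_ge (R : realType) (u : (\bar R)^nat) (c : \bar R) N :
  (forall n, (N <= n)%N -> (c <= u n)%E) -> (c <= limn_einf u)%E.
Proof.
move=> cu; rewrite limn_einf_lim (cvg_lim _ (@cvg_einfs_sup _ u))//.
apply: le_trans (ereal_sup_ubound _); last by exists N.
by apply: le_ereal_inf_tmp => _ [n /= Nn <-]; exact: cu.
Qed.

Lemma uniformly_transient_escape (R : realType) (V : choiceType) (G : simple_graph V)
    (lf : locally_finite G) (dg : forall x : V, (0 < degree G x)%N)
    (d : measure_display) (Omega : measurableType d)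
    (P : V -> probability Omega R) (X : nat -> Omega -> V)
    (X_srw : forall o : V, is_srw G o (P o) X) :
  uniformly_transient P X ->
  exists2 delta : R, 0 < delta <= 1 &
    forall n y, nb_mean G (hit R G n y) y < 1 - delta.
Proof.
move=> ut; suff [e e0 le] : exists2 e : R, 0 < e <= 1 &
    (e%:E <= ereal_inf [set P o (no_return o X) | o in [set: V]])%E.
  (* Halving makes the bound on the return probability strict. *)
  exists (e / 2); first lra.
  move=> n y; have : (e%:E <= (1 - nb_mean G (hit R G n y) y)%:E)%E.
    apply: le_trans (prob_no_return_le lf dg (X_srw y) n).
    by apply: (le_trans le); apply: ereal_inf_lbound; exists y.
  rewrite lee_fin; lra.
move: ut; rewrite /uniformly_transient; case: ereal_inf => [r| |]//.
  rewrite lte_fin => r0; exists (Num.min r 1).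
    by rewrite lt_min r0 ltr01 ge_min lexx orbT.
  by rewrite lee_fin ge_min lexx.
(* The value [+oo] is the infimum over an empty vertex set. *)
by move=> _; exists 1; rewrite ?ltr01 ?lexx// leey.
Qed.

Lemma exists_expr_lt (R : realType) (C rho : R) : 0 < rho < 1 ->
  exists r, C * rho ^+ r < 1.
Proof.
move=> /andP[rho0 rho1].
have : (C * rho ^+ n) @[n --> \oo] --> (C * 0 : R).
  by apply: cvgMr; apply: cvg_expr; rewrite gtr0_norm.
rewrite mulr0 => /cvgr_lt /(_ 1 ltr01)[r _ Hr]; exists r.
exact: Hr (leqnn r).
Qed.

(** Rounding down and the [- 1] cost at most [c + 1], which half of the slope [c / k.+1] absorbs
    once [n.+1] is at least [2 * k.+1 * (1 + c^-1)]. *)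
Lemma linear_growth (R : realType) (c : R) k : 0 < c ->
  exists N : nat, forall n, (N <= n)%N ->
    c / (2 * k.+1%:R) * n.+1%:R <= c * (n.+1 %/ k.+1)%:R - 1.
Proof.
move=> c0; set K : R := k.+1%:R; have K0 : 0 < K by rewrite ltr0n.
have c1 : c * (1 + c^-1) = c + 1 by rewrite mulrDr mulr1 mulfV// gt_eqF.
have bound0 : 0 <= 2 * K * (1 + c^-1).
  by rewrite !mulr_ge0 ?addr_ge0 ?invr_ge0 ?ltW.
exists (Num.bound (2 * K * (1 + c^-1))) => n Nn.
have big : 2 * K * (1 + c^-1) <= n.+1%:R.
  by apply: (le_trans (ltW (archi_boundP bound0))); rewrite ler_nat ltnW.
have small : n.+1%:R <= (n.+1 %/ k.+1)%:R * K + K.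
  rewrite -natrM -natrD ler_nat {1}(divn_eq n.+1 k.+1) leq_add2l.
  by rewrite ltnW// ltn_mod.
set q : R := (_ %/ _)%:R in small *; set N : R := n.+1%:R in big small *.
have tK : c / (2 * K) * (2 * K) = c by rewrite mulfVK// gt_eqF// mulr_gt0.
set t := c / (2 * K) in tK *.
have t0 : 0 <= t by rewrite divr_ge0 ?ltW// mulr_gt0.
have lower : c + 1 <= t * N.
  by rewrite -c1 -[X in X * _]tK -mulrA ler_wpM2l// mulrA.
have upper : t * N <= t * (q * K + K) by rewrite ler_wpM2l.
have : t * (q * K + K) * 2 = c * q + c by rewrite -tK; ring.
lra.
Qed.

Theorem theorem1p1 (R : realType) (V : choiceType) (G : simple_graph V)
    (G_locally_finite : locally_finite G)
    (G_degree_gt0 : forall x : V, (0 < degree G x)%N)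
    (d : measure_display) (Omega : measurableType d)
    (P : V -> probability Omega R) (X : nat -> Omega -> V)
    (X_srw : forall o : V, is_srw G o (P o) X)
    (G_transient : uniformly_transient P X)
    (G_bounded : bounded_degrees G) :
  (0 < limn_einf (fun n : nat =>
         ereal_inf [set range_entropy G o (P o) X n / mean_range (P o) X n
                   | o in [set: V]]))%E.
Proof.
have lf := G_locally_finite; have dg := G_degree_gt0.
have [D [D1 degD]] : exists D, (1 < D)%N /\ forall x, (degree G x <= D)%N.
  (* The maximum with 2 keeps [1 - 1/D] positive. *)
  have [D0 D0P] := G_bounded; exists (maxn D0 2); split; first by rewrite leq_max orbT.
  by move=> x; rewrite (leq_trans (D0P x))// leq_maxl.
have D0 : 0 < D%:R :> R by rewrite ltr0n (ltn_trans _ D1).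
have [delta /andP[delta0 delta1] escape] := uniformly_transient_escape lf dg X_srw G_transient.
(* Then [rho * rho] is [1 - delta + delta^2 / 4], which gives [delta_rho]. *)
pose rho := 1 - delta / 2.
have rho0 : 0 < rho by rewrite /rho; lra.
have rho1 : rho < 1 by rewrite /rho; lra.
have delta_rho : 1 - delta <= rho * rho by rewrite /rho; have := sqr_ge0 delta; lra.
have [r small] : exists r, delta^-1 * rho ^+ r * D%:R < 1.
  have [|r rP] := @exists_expr_lt _ (delta^-1 * D%:R) rho; first by rewrite rho0.
  by exists r; rewrite mulrAC.
(* The boundary gained per block of [r.+1] times, from [mean_boundary_ge]. *)
pose c := (1 - rho) * (delta * D%:R^-1 ^+ r) / D.+1%:R.
have c0 : 0 < c.
  by rewrite /c divr_gt0// mulr_gt0 ?subr_gt0// mulr_gt0// exprn_gt0// invr_gt0.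
have boundary n o : c * (n.+1 %/ r.+1)%:R <=
    path_mean G n (fun p => #|` inner_boundary G (vset p)|%:R) o.
  have := mean_boundary_ge lf dg degD delta0 escape rho0 (ltW rho1) delta_rho o
    small (leq_trunc_div n.+1 r.+1).
  rewrite -ler_pdivrMl//; apply: le_trans.
  by rewrite /c [_ / _]mulrC -!mulrA [_ ^+ r * _]mulrC.
pose L : R := ln (1 - D%:R^-1)^-1.
have L0 : 0 < L.
  have Dinv : D%:R^-1 < 1 :> R by rewrite invf_lt1// ltr1n.
  have Dinv0 : 0 < D%:R^-1 :> R by rewrite invr_gt0.
  by rewrite ln_gt0// invf_gt1; lra.
have [N NP] := @linear_growth R c r c0.
apply: (@lt_le_trans _ _ (L * (c / (2 * r.+1%:R)))%:E).
  by rewrite lte_fin mulr_gt0// divr_gt0// mulr_gt0.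
apply: (@limn_einf_ge _ _ _ N) => n Nn; apply: le_ereal_inf_tmp => _ [x _ <-].
(* The ratio is bounded factor by factor: the entropy from below, and the mean range by [n.+1] from
   above. *)
apply: (@le_trans _ _ ((L * (c / (2 * r.+1%:R) * n.+1%:R))%:E * n.+1%:R^-1%:E)%E).
  by rewrite -EFinM lee_fin -!mulrA mulfV ?mulr1.
apply: lee_pmul.
- by rewrite lee_fin mulr_ge0 ?ltW// mulr_gt0// divr_gt0// mulr_gt0.
- by rewrite lee_fin invr_ge0.
- apply: le_trans (range_entropy_ge lf dg (X_srw x) n degD D1).
  rewrite lee_fin ler_pM2l// (le_trans (NP n Nn))// lerB//.
have -> : n.+1%:R^-1%:E = (n.+1%:R%:E)^-1%E :> \bar R by rewrite inver gt_eqF.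
by rewrite lee_pV2 ?inE ?mean_range_le ?mean_range_ge0// lee_fin.
Qed.
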